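(* Let $(A,\mu_A)$ be an associative algebra over $\mathbf{k}$ and $M$ be an $A$-module in the usual sense with structure map $\rho \colon A \otimes M \to M$. Suppose $\alpha_A \colon A \to A$ is an algebra morphism and $\alpha_M \colon M \to M$ is a linear self-map such that \[ \alpha_M \circ \rho = \rho \circ (\alpha_A \otimes \alpha_M). \] For any integers $n,k \geq 0$, define the map \[ \rho_\alpha^{n,k} = \alpha_M^{2^k} \circ \rho \circ (\alpha_A^{n} \otimes Id_M) \colon A \otimes M \to M. \] Then each $\rho_\alpha^{n,k}$ gives the Hom-module $M^k_\alpha = (M,\alpha_M^{2^k})$ the structure of an $A_\beta$-module, where $\beta = \alpha_A^{2^k}$ and $A_\beta$ is the Hom-associative algebra $(A,\ \mu_\beta = \beta \circ \mu_A,\ \beta)$.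
   Context: $\mathbf{k}$ is a fixed associative and commutative ring of characteristic $0$; modules, tensor products and linear maps are over $\mathbf{k}$. For a self-map $\alpha$, $\alpha^n$ is the $n$-fold composition, $\alpha^0 = Id$. An $A$-module in the usual sense over an associative algebra $(A,\mu_A)$ satisfies $\rho\circ(Id_A\otimes\rho)=\rho\circ(\mu_A\otimes Id_M)$. A Hom-associative algebra $(B,\mu,\alpha_B)$ is a $\mathbf{k}$-module $B$ with linear maps $\mu\colon B^{\otimes 2}\to B$, $\alpha_B\colon B\to B$ such that $\alpha_B\circ\mu=\mu\circ\alpha_B^{\otimes 2}$ and $\mu\circ(\alpha_B\otimes\mu)=\mu\circ(\mu\otimes\alpha_B)$. A Hom-module is a pair $(M,\alpha_M)$ of a $\mathbf{k}$-module $M$ and a linear self-map $\alpha_M\colon M\to M$. For a Hom-associative algebra $(B,\mu,\alpha_B)$, a $B$-module is a Hom-module $(M,\alpha_M)$ with a linear map $\rho\colon B\otimes M\to M$ (the structure map) such that $\alpha_M\circ\rho=\rho\circ(\alpha_B\otimes\alpha_M)$ (multiplicativity) and $\rho\circ(\alpha_B\otimes\rho)=\rho\circ(\mu\otimes\alpha_M)$ (Hom-associativity). *)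

(* Defs.v *)
From mathcomp Require Import all_boot all_algebra.

Set Implicit Arguments.
Unset Strict Implicit.
Unset Printing Implicit Defensive.

Import GRing.Theory.
Local Open Scope ring_scope.

Definition char_zero (K : pzRingType) : Prop :=
  forall n : nat, n%:R = 0 :> K -> n = 0%N.

(* A linear map U (x) V -> W is given by the corresponding bilinear map
   U -> V -> W, and an equality of linear maps out of a tensor product by its
   values on pure tensors.  Algebras and modules need not be unital. *)
Local Notation bilinear_map f := (bilinear_for *:%R *:%R f).

Section AssociativeAlgebras.
Variables (K : comNzRingType) (A M : lmodType K).

Record is_assoc_algebra (mu : A -> A -> A) : Prop := IsAssocAlgebra {
  assoc_alg_bilinear : bilinear_map mu;
  assoc_alg_associative : forall x y z, mu x (mu y z) = mu (mu x y) z
}.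

Record is_module (mu : A -> A -> A) (rho : A -> M -> M) : Prop := IsModule {
  module_bilinear : bilinear_map rho;
  module_associative : forall x y m, rho x (rho y m) = rho (mu x y) m
}.

Record is_algebra_morphism (mu : A -> A -> A) (f : A -> A) : Prop :=
  IsAlgebraMorphism {
    algebra_morphism_linear : linear f;
    algebra_morphism_mul : forall x y, f (mu x y) = mu (f x) (f y)
  }.

End AssociativeAlgebras.

Section HomAlgebras.
Variables (K : comNzRingType) (B M : lmodType K).

Record is_hom_assoc_algebra (mu : B -> B -> B) (alphaB : B -> B) : Prop :=
  IsHomAssocAlgebra {
    hom_alg_bilinear : bilinear_map mu;
    hom_alg_linear : linear alphaB;
    hom_alg_multiplicative :
      forall x y, alphaB (mu x y) = mu (alphaB x) (alphaB y);
    hom_alg_associative :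
      forall x y z, mu (alphaB x) (mu y z) = mu (mu x y) (alphaB z)
  }.

Definition is_hom_module (alphaM : M -> M) : Prop := linear alphaM.

(* (M, alphaM) with structure map rho is a module over (B, mu, alphaB); that
   the latter is a Hom-associative algebra is a separate condition. *)
Record is_hom_alg_module (mu : B -> B -> B) (alphaB : B -> B)
    (alphaM : M -> M) (rho : B -> M -> M) : Prop := IsHomAlgModule {
  hom_alg_module_hom_module : is_hom_module alphaM;
  hom_alg_module_bilinear : bilinear_map rho;
  hom_alg_module_multiplicative :
    forall x m, alphaM (rho x m) = rho (alphaB x) (alphaM m);
  hom_alg_module_associative :
    forall x y m, rho (alphaB x) (rho y m) = rho (mu x y) (alphaM m)
}.

End HomAlgebras.

Section Twisting.
Variables (K : comNzRingType) (A M : lmodType K).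

Definition twist_mul (beta : A -> A) (mu : A -> A -> A) : A -> A -> A :=
  fun x y => beta (mu x y).

Definition twist_action (alphaA : A -> A) (alphaM : M -> M)
    (rho : A -> M -> M) (n k : nat) : A -> M -> M :=
  fun x m => iter (2 ^ k) alphaM (rho (iter n alphaA x) m).

End Twisting.

(* Main.v *)
Require Import Defs.
From mathcomp Require Import all_boot all_algebra.

(** The theorem is an instance of twisting by arbitrary, not iterated, maps.
    Let [b] and [a] be commuting algebra endomorphisms of [A], and [f] a linear
    self-map of [M] with [f (x m) = b x (f m)].  For the action
    [x . m = f (a x m)], both sides of Hom-associativity reduce to the same
    vector: [f] distributes over a product as [b] on the scalar and [f] on the
    vector, so that the [b] that Hom-associativity puts on [x] on the left, and
    on the product [x y] on the right, is always absorbed into a second [f]: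

      [b x . (y . m) = f (b (a x) (f (a y m))) = f (f (a x (a y m)))],

      [b (x y) . f m = f (b (a (x y)) (f m)) = f (f (a (x y) m))],

    and these agree because [a] is multiplicative and [M] is a module.  The
    commutation of [a] with [b] is what allows [a (b x)] to be read as
    [b (a x)].  The twisted algebra is the same computation for [A] acting on
    itself, with [a] the identity and [f = b].

    It remains to see that the hypotheses on [alphaA] and [alphaM] pass to their
    iterates, with the same exponent [2 ^ k] on scalars and vectors, and that
    two iterates of one map commute. *)

Set Implicit Arguments.
Unset Strict Implicit.
Unset Printing Implicit Defensive.

Local Open Scope ring_scope.

Local Notation bilinear_map f := (bilinear_for *:%R *:%R f).

Lemma iter_morph2 (T U V : Type) (op : T -> U -> V)
    (f : T -> T) (g : U -> U) (h : V -> V) (N : nat) :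
  (forall x y, h (op x y) = op (f x) (g y)) ->
  forall x y, iter N h (op x y) = op (iter N f x) (iter N g y).
Proof. by move=> hop x y; elim: N => //= N ->. Qed.

Lemma iter_comm (T : Type) (f : T -> T) (m n : nat) (x : T) :
  iter m f (iter n f x) = iter n f (iter m f x).
Proof. by rewrite -!iterD addnC. Qed.

Lemma linear_iter (K : comNzRingType) (V : lmodType K) (f : V -> V) (N : nat) :
  linear f -> linear (iter N f).
Proof. by move=> linf c u v; elim: N => //= N ->; rewrite linf. Qed.

Lemma algebra_morphism_iter (K : comNzRingType) (A : lmodType K)
    (mu : A -> A -> A) (f : A -> A) (N : nat) :
  is_algebra_morphism mu f -> is_algebra_morphism mu (iter N f).
Proof.
by case=> linf mulf; split; [apply: linear_iter | apply: iter_morph2].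
Qed.

Lemma bilinear_twist (K : comNzRingType) (U V W : lmodType K)
    (op : U -> V -> W) (a : U -> U) (f : W -> W) :
  bilinear_map op -> linear a -> linear f ->
  bilinear_map (fun x y => f (op (a x) y)).
Proof.
case=> opl opr lina linf; split=> [y | x] c u v /=.
- by rewrite lina opl linf.
- by rewrite opr linf.
Qed.

Lemma twist_hom_assoc_algebra (K : comNzRingType) (A : lmodType K)
    (mu : A -> A -> A) (b : A -> A) :
  is_assoc_algebra mu -> is_algebra_morphism mu b ->
  is_hom_assoc_algebra (twist_mul b mu) b.
Proof.
case=> bilmu assoc [linb mulb]; split; rewrite /twist_mul //.
- exact: (@bilinear_twist K A A A mu id b).
- by move=> x y; rewrite -mulb.
- by move=> x y z; rewrite -!mulb assoc.
Qed.

(** Keeping [a] independent of [f] and [b], up to commutation with [b], is what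
    lets the exponent [n] of the theorem be unrelated to [2 ^ k]. *)
Lemma twist_hom_alg_module (K : comNzRingType) (A M : lmodType K)
    (mu : A -> A -> A) (rho : A -> M -> M) (a b : A -> A) (f : M -> M) :
  is_module mu rho -> is_algebra_morphism mu a ->
  (forall x, a (b x) = b (a x)) -> linear f ->
  (forall x m, f (rho x m) = rho (b x) (f m)) ->
  is_hom_alg_module (twist_mul b mu) b f (fun x m => f (rho (a x) m)).
Proof.
case=> bilrho assoc [lina mula] comm_ab linf frho; split=> //.
- exact: (@bilinear_twist K A M M rho a f).
- by move=> x m; rewrite comm_ab -frho.
- by move=> x y m; rewrite /twist_mul !comm_ab -!frho assoc mula.
Qed.

Theorem theorem4p5 (K : comNzRingType) (charK : char_zero K)
    (A M : lmodType K)
    (muA : A -> A -> A) (rho : A -> M -> M)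
    (alphaA : A -> A) (alphaM : M -> M)
    (assocA : is_assoc_algebra muA)
    (modM : is_module muA rho)
    (morphA : is_algebra_morphism muA alphaA)
    (linM : linear alphaM)
    (compat : forall x m, alphaM (rho x m) = rho (alphaA x) (alphaM m))
    (n k : nat) :
  let beta := iter (2 ^ k) alphaA in
  is_hom_assoc_algebra (twist_mul beta muA) beta /\
  is_hom_alg_module (twist_mul beta muA) beta (iter (2 ^ k) alphaM)
    (twist_action alphaA alphaM rho n k).
Proof.
move=> beta; split.
- by apply: twist_hom_assoc_algebra => //; apply: algebra_morphism_iter.
- apply: (@twist_hom_alg_module K A M muA rho (iter n alphaA)) => //.
  + exact: algebra_morphism_iter.
  + by move=> x; apply: iter_comm.
  + exact: linear_iter.
  + exact: iter_morph2.
Qed.
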